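(* For every graph $G$ and every $\lceil\sqrt{30}\,\Delta(G)^{3/2}+\Delta(G)+\frac13\rceil$-assignment $L$ of $G$, there exist at least $(7.5\,\Delta(G)^3)^{|V(G)|/2}$ proper $L$-colorings $\varphi$ of $G$ such that every 4-vertex path in $G$ has a color used exactly once (that is, some color is used by $\varphi$ on exactly one of its four vertices), and for every vertex $v$ with $d_G(v)\ge 3$ and for any three neighbors of $v$, some color is used exactly once on those three neighbors. In particular, for each such $\varphi$, every component of the subgraph of $G$ induced by any two arbitrarily chosen color classes of $\varphi$ is a path on at most three vertices.
   Context: Graphs are finite and simple. $d_G(v)$ is the degree of $v$ and $\Delta(G)$ the maximum degree of $G$. A 4-vertex path in $G$ is a (not necessarily induced) subgraph of $G$ that is a path on four distinct vertices. A coloring is a map $\varphi\colon V(G)\to\mathbb{Z}^+$; it is proper if adjacent vertices get different colors. For a real number $a$, an $a$-assignment $L$ assigns to each vertex $v$ a set $L(v)\subseteq\mathbb{Z}^+$ with $|L(v)|\ge a$; an $L$-coloring is a coloring with $\varphi(v)\in L(v)$ for all $v$. A path on at most three vertices may consist of a single vertex. *)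

(* Defs.v *)
From HB Require Import structures.
From mathcomp Require Import all_boot all_order all_algebra.
From mathcomp Require Import all_classical all_reals all_analysis.

Set Implicit Arguments.
Unset Strict Implicit.
Unset Printing Implicit Defensive.

Local Open Scope nat_scope.

(* A finite simple graph is a symmetric irreflexive relation e on a finType V.
   Colors are the positive natural numbers: colorings take values in nat, and
   list assignments only contain positive numbers. *)

Section Graph.
Variables (V : finType) (e : rel V).

Definition simple_graph : Prop := symmetric e /\ irreflexive e.

Definition neighbors (v : V) : {set V} := [set w | e v w].

Definition degree (v : V) : nat := #|neighbors v|.

Definition max_degree : nat := \max_(v : V) degree v.

(* Not necessarily induced: only consecutive vertices must be adjacent. *)
Definition is_path4 (p : seq V) : bool :=
  [&& size p == 4, uniq p & sorted e p].

Definition induced_rel (S : {set V}) : rel V :=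
  [rel x y | [&& x \in S, y \in S & e x y]].

Definition is_component (S C : {set V}) : Prop :=
  exists2 x, x \in S & C = [set y | connect (induced_rel S) x y].

(* The subgraph induced by C is a path (possibly a single vertex): C can be
   listed without repetition so that two vertices are adjacent if and only if
   they are consecutive. *)
Definition induces_path (C : {set V}) : Prop :=
  exists p : seq V,
    [/\ 0 < size p, uniq p, C = [set x in p] &
        forall x y, x \in p -> y \in p ->
          e x y = ((index x p).+1 == index y p) || ((index y p).+1 == index x p)].

End Graph.

Section Coloring.
Variables (V : finType) (e : rel V).
Implicit Type phi : {ffun V -> nat}.

Definition proper phi : Prop := forall x y, e x y -> phi x != phi y.

(* [counting] is the cardinality of a set, +oo when it is infinite, so infinite
   lists are allowed. *)
Definition list_assignment (R : realType) (a : R) (L : V -> set nat) : Prop :=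
  forall v, (L v `<=` [set c | 0 < c])%classic /\ (a%:E <= counting (L v))%E.

Definition list_coloring (L : V -> set nat) phi : Prop := forall v, L v (phi v).

Definition color_class phi (c : nat) : {set V} := [set x | phi x == c].

Definition has_color_used_once phi (A : {set V}) : Prop :=
  exists c, #|A :&: color_class phi c| = 1.

Definition path4_condition phi : Prop :=
  forall p : seq V, is_path4 e p -> has_color_used_once phi [set x in p].

Definition neighbors3_condition phi : Prop :=
  forall v, 3 <= degree e v ->
    forall A : {set V}, A \subset neighbors e v -> #|A| = 3 ->
      has_color_used_once phi A.

Definition good_coloring (L : V -> set nat) phi : Prop :=
  [/\ proper phi, list_coloring L phi, path4_condition phi
    & neighbors3_condition phi].

End Coloring.

(* Main.v *)
Require Import Defs.
From HB Require Import structures.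
From mathcomp Require Import all_boot all_order all_algebra.
From mathcomp Require Import all_classical all_reals all_analysis.
From mathcomp Require Import ring lra.
Set Implicit Arguments.
Unset Strict Implicit.
Unset Printing Implicit Defensive.

Import Order.TTheory GRing.Theory Num.Theory.
Local Open Scope ring_scope.

(** Rosenfeld's counting argument gives the number of colorings. A proper
    coloring fails the two local conditions only if
    - some 4-vertex path [a b c d] has phi a = phi c and phi b = phi d (a proper
      coloring of a path that uses no color exactly once alternates), or
    - three neighbors of a vertex all have the same color.
    Seen from a vertex v of the violated configuration, both have the same
    shape: there are three other vertices u, x, y (with x = y in the second
    case) such that phi v = phi x and phi u = phi y. Call (u, x, y) an
    obstruction at v; there are at most 3 Delta^3 of them.

    Let F(S) be the number of valid partial colorings with domain S, where v is
    in S. Among the |L(v)| F(S - v) ways to extend a valid coloring of S - v to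
    v, at most Delta F(S - v) clash with a neighbor of v. A given obstruction
    (u, x, y) is realized by at most F(S - v - u) extensions, because the colors
    of v and u are determined by those of x and y. If beta F(S - v - u) <=
    F(S - v), which holds by induction, then
      F(S) >= (|L(v)| - Delta - 3 Delta^3 / beta) F(S - v) >= beta F(S - v)
    as soon as |L(v)| >= beta + Delta + 3 Delta^3 / beta; so F(V) >= beta^|V|
    ([exp_le_valid_colorings]). With beta = sqrt (7.5 Delta^3) the required list
    size is at most 2 beta + Delta = sqrt 30 Delta^(3/2) + Delta
    ([list_size_bound]).

    For the structure of two color classes, the induced subgraph is bipartite
    with the colors as sides. So a 4-vertex path in it would use each of its two
    colors twice, and three neighbors of a vertex would all have the other
    color. Hence its components have neither a 4-vertex path nor a vertex of
    degree 3, which leaves only paths on at most three vertices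
    ([bicolored_component]). *)

(** * Counting partial colorings *)


Lemma weighted_card_bigcup (R : realFieldType) (I U : finType) (A : {set I})
    (X : I -> {set U}) (b c : R) :
  0 <= b -> (forall i, i \in A -> b * #|X i|%:R <= c) ->
  b * #|\bigcup_(i in A) X i|%:R <= #|A|%:R * c.
Proof.
move=> b0 Xc; rewrite -[#|A|]sum1_card natr_sum mulr_suml.
apply: (big_ind2 (fun (B : {set U}) (s : R) => b * #|B|%:R <= s)) => //.
- by rewrite cards0 mulr0.
- move=> B s C t Bs Ct; apply: le_trans (lerD Bs Ct).
  rewrite -mulrDr -natrD; apply: ler_wpM2l => //.
  by rewrite ler_nat leq_card_setU.
- by move=> i Ai; rewrite mul1r Xc.
Qed.

Section PartialColorings.
Variables (V K : finType) (e : rel V) (k0 : K) (L : V -> {set K}).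
Variable T : V -> {set V * V * V}.
Implicit Types (f g : {ffun V -> K}) (S : {set V}).

(** A partial coloring with domain [S] is a total function that takes the
    default value [k0] outside [S], so that the partial colorings with a given
    domain form a finite set, in bijection with functions on [S]. *)
Definition valid_on S f : Prop :=
  [/\ forall x, x \in S -> f x \in L x,
      forall x, x \notin S -> f x = k0,
      forall x y, x \in S -> y \in S -> e x y -> f x != f y
    & forall v u x y, (u, x, y) \in T v ->
        v \in S -> u \in S -> x \in S -> y \in S ->
        f v = f x -> f u = f y -> False].

Definition valid_colorings S : {set {ffun V -> K}} := [set f | `[< valid_on S f >]].

Lemma valid_coloringsP S f : reflect (valid_on S f) (f \in valid_colorings S).
Proof. by rewrite inE; exact: asboolP. Qed.

Definition recolor f (v : V) (c : K) : {ffun V -> K} :=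
  [ffun x => if x == v then c else f x].

Lemma recolor_same f v c : recolor f v c v = c.
Proof. by rewrite ffunE eqxx. Qed.

Lemma recolor_other f v c x : x != v -> recolor f v c x = f x.
Proof. by rewrite ffunE => /negPf->. Qed.

Lemma valid_erase S f v : valid_on S f -> valid_on (S :\ v) (recolor f v k0).
Proof.
case=> fL fk0 fe fT.
have rE x : x \in S :\ v -> recolor f v k0 x = f x.
  by rewrite !inE => /andP[xv _]; exact: recolor_other.
split.
- by move=> x xS; rewrite rE //; apply: fL; move: xS; rewrite !inE => /andP[].
- move=> x; rewrite !inE negb_and negbK ffunE; case: eqP => //= _; exact: fk0.
- move=> x y xS yS exy; rewrite !rE //.
  by move: xS yS; rewrite !inE => /andP[_ xS] /andP[_ yS]; exact: fe.
- move=> w u x y t wS uS xS yS; rewrite !rE //.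
  move: wS uS xS yS; rewrite !inE => /andP[_ wS] /andP[_ uS] /andP[_ xS] /andP[_ yS].
  exact: fT t wS uS xS yS.
Qed.

Lemma valid_colorings0 : #|valid_colorings finset.set0| = 1%N.
Proof.
rewrite -(cards1 [ffun _ : V => k0]); apply: eq_card => f; rewrite !inE.
apply/asboolP/eqP => [[_ fk0 _ _]|->].
  by apply/ffunP => x; rewrite ffunE fk0 // inE.
by split=> [x|x _|x y|v u x y _]; rewrite ?inE // ffunE.
Qed.

Hypothesis e_sym : symmetric e.
Hypothesis e_irr : irreflexive e.
Hypothesis T_neq : forall v u x y, (u, x, y) \in T v ->
  [/\ u != v, x != v, y != v, x != u & y != u].
(** [T_move] is what makes the induction local: a forbidden configuration can be
    described from any of its vertices, so when [v] is colored last only the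
    triples in [T v] need checking. *)
Hypothesis T_move : forall v u x y w,
  (u, x, y) \in T v -> w \in [:: v; u; x; y] ->
  exists u' x' y', [/\ (u', x', y') \in T w,
    {subset [:: u'; x'; y'] <= [:: v; u; x; y]}
  & forall f, f v = f x -> f u = f y -> f w = f x' /\ f u' = f y'].

Lemma valid_extend S v g c : v \in S -> valid_on (S :\ v) g -> c \in L v ->
    (forall w, e v w -> c != g w) ->
    (forall u x y, (u, x, y) \in T v -> u \in S -> x \in S -> y \in S ->
       c = g x -> g u = g y -> False) ->
  valid_on S (recolor g v c).
Proof.
move=> vS [gL gk0 ge gT] cL ce cT.
have inSv x : x != v -> x \in S -> x \in S :\ v by rewrite !inE => -> ->.
split.
- move=> x xS; case: (eqVneq x v) => [->|xv]; first by rewrite recolor_same.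
  by rewrite recolor_other //; apply/gL/inSv.
- move=> x xS; have xv : x != v by apply: contraNneq xS => ->.
  by rewrite recolor_other // gk0 // !inE negb_and xS orbT.
- move=> x y xS yS exy; case: (eqVneq x v) => [xv|xv].
    have yv : y != v by apply: contraTneq exy => ->; rewrite xv e_irr.
    by rewrite xv recolor_same recolor_other // ce // -xv.
  case: (eqVneq y v) => [yv|yv].
    by rewrite yv recolor_same recolor_other // eq_sym ce // e_sym -yv.
  by rewrite !recolor_other // ge ?inSv.
- move=> w u x y t wS uS xS yS fwx fuy.
  have allS z : z \in [:: w; u; x; y] -> z \in S.
    by rewrite !inE => /or4P[] /eqP->.
  case: (boolP (v \in [:: w; u; x; y])) => [vt|].
    have [u' [x' [y' [t' sub eqs]]]] := T_move t vt.
    have [uv xv yv _ _] := T_neq t'.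
    have [] := eqs _ fwx fuy; rewrite recolor_same !recolor_other // => c1 c2.
    by apply: (cT _ _ _ t') => //; apply/allS/sub; rewrite !inE eqxx ?orbT.
  rewrite !inE !negb_or ![v == _]eq_sym => /and4P[wv uv xv yv].
  by move: fwx fuy; rewrite !recolor_other //; apply: (gT _ _ _ _ t); apply: inSv.
Qed.

Variables (R : realFieldType) (beta : R) (d m : nat).
Hypothesis beta_gt0 : 0 < beta.
Hypothesis deg_le : forall v, (#|neighbors e v| <= d)%N.
Hypothesis T_le : forall v, (#|T v| <= m)%N.
Hypothesis L_ge : forall v, beta + d%:R + m%:R / beta <= #|L v|%:R.

(** The extensions of the valid colorings of [S :\ v] to [v] are the pairs in
    [D]. Each pair is good, clashes with a neighbor, or realizes an obstruction
    [(u, x, y)]. In the last case erasing [u] as well loses nothing, as the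
    colors of [v] and [u] can be read off at [x] and [y]; these vertices survive
    the erasure by [T_neq]. *)
Lemma valid_colorings_step S v : v \in S ->
    (forall u, u \in S :\ v ->
       beta * #|valid_colorings (S :\ v :\ u)|%:R <= #|valid_colorings (S :\ v)|%:R) ->
  beta * #|valid_colorings (S :\ v)|%:R <= #|valid_colorings S|%:R.
Proof.
move=> vS IH; set F := valid_colorings (S :\ v); set n : R := #|F|%:R.
pose D := finset.setX F (L v).
pose clash w := [set p in D | p.2 == p.1 w].
pose obstructed (t : V * V * V) := [set p in D |
  [&& t.1.1 \in S, t.1.2 \in S, t.2 \in S, p.2 == p.1 t.1.2 & p.1 t.1.1 == p.1 t.2]].
pose good := [set p in D | recolor p.1 v p.2 \in valid_colorings S].
have cover : D \subset good :|: (\bigcup_(w in neighbors e v) clash w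
                               :|: \bigcup_(t in T v) obstructed t).
  apply/fintype.subsetP => -[g c] pD; rewrite inE; apply/orP.
  case: (boolP ((g, c) \in _ :|: _)) => [|nbad]; [by right | left].
  move: nbad; rewrite inE negb_or => /andP[/bigcupP nclash /bigcupP nobs].
  rewrite [_ \in good]inE pD /=; apply/valid_coloringsP.
  have [gF cL] : valid_on (S :\ v) g /\ c \in L v.
    by have := pD; rewrite inE => /andP[/valid_coloringsP].
  apply: valid_extend => //.
    move=> w evw; apply/negP => /eqP cw; case: nclash; exists w; rewrite !inE //.
    by move: pD; rewrite !inE /= => -> /=; rewrite cw.
  move=> u x y t uS xS yS cx uy; case: nobs; exists (u, x, y) => //.
  by rewrite inE pD /= uS xS yS cx uy !eqxx.
have D_le : (#|D| <= #|good| + (#|\bigcup_(w in neighbors e v) clash w|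
                               + #|\bigcup_(t in T v) obstructed t|))%N.
  apply: leq_trans (subset_leq_card cover) _.
  by rewrite (leq_trans (leq_card_setU _ _)) // leq_add2l leq_card_setU.
have good_le : (#|good| <= #|valid_colorings S|)%N.
  rewrite -(@card_in_imset _ _ (fun p : {ffun V -> K} * K => recolor p.1 v p.2)).
    apply/subset_leq_card/fintype.subsetP => _ /imsetP[p + ->].
    by rewrite [_ \in good]inE => /andP[].
  have off (p : {ffun V -> K} * K) : p \in good -> p.1 v = k0.
    rewrite !inE => /andP[/andP[/asboolP[_ gk _ _] _] _].
    by apply: gk; rewrite !inE eqxx.
  move=> [g c] [g' c'] /off/= gv /off/= gv' /ffunP E.
  congr pair; last by have := E v; rewrite !recolor_same.
  apply/ffunP => x; case: (eqVneq x v) => [->|xv]; first by rewrite gv gv'.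
  by have := E x; rewrite !recolor_other.
have clash_le : 1 * #|\bigcup_(w in neighbors e v) clash w|%:R <= d%:R * n.
  apply: le_trans (_ : #|neighbors e v|%:R * n <= _); last first.
    by rewrite ler_wpM2r ?ler0n // ler_nat.
  apply: weighted_card_bigcup => // w _; rewrite mul1r ler_nat.
  apply: leq_trans (leq_imset_card (fun g : {ffun V -> K} => (g, g w)) _).
  apply/subset_leq_card/fintype.subsetP => -[g c]; rewrite inE finset.in_setX /=.
  by case/andP=> /andP[gF _] /eqP->; apply/imsetP; exists g.
have obs_le : beta * #|\bigcup_(t in T v) obstructed t|%:R <= m%:R * n.
  apply: le_trans (_ : #|T v|%:R * n <= _); last first.
    by rewrite ler_wpM2r ?ler0n // ler_nat.
  apply: weighted_card_bigcup (ltW beta_gt0) _ => -[[u x] y] t.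
  have [uv xv yv xu yu] := T_neq t.
  case: (boolP (u \in S)) => [uS|/negPf uS]; last first.
    rewrite (_ : obstructed _ = finset.set0) ?cards0 ?mulr0 ?ler0n //.
    by apply/finset.setP => p; rewrite !inE /= uS /= andbF.
  apply: le_trans (IH u _); last by rewrite !inE uv.
  rewrite ler_pM2l // ler_nat.
  apply: leq_trans (leq_imset_card
    (fun h : {ffun V -> K} => (recolor h u (h y), h x)) _).
  apply/subset_leq_card/fintype.subsetP => -[g c]; rewrite inE finset.in_setX /=.
  move=> /andP[/andP[/valid_coloringsP gF _] /and5P[_ _ _ /eqP-> /eqP guy]].
  apply/imsetP; exists (recolor g u k0).
    by apply/valid_coloringsP/valid_erase.
  rewrite !(recolor_other _ _ xu, recolor_other _ _ yu); congr pair.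
  by apply/ffunP => z; rewrite !ffunE; case: eqP => // ->.
have cardD : #|D|%:R = n * #|L v|%:R by rewrite cardsX natrM.
move: D_le good_le; rewrite -!(ler_nat R) !natrD cardD.
have Lv := ler_wpM2l (ler0n R #|F|) (L_ge v).
have obs_le' : #|\bigcup_(t in T v) obstructed t|%:R <= n * (m%:R / beta).
  by rewrite mulrA ler_pdivlMr // mulrC [n * _]mulrC.
move: Lv; rewrite -/n !mulrDr; move: clash_le obs_le'; lra.
Qed.

Lemma valid_colorings_growth S v : v \in S ->
  beta * #|valid_colorings (S :\ v)|%:R <= #|valid_colorings S|%:R.
Proof.
have [k] := ubnP #|S|; elim: k S v => // k IH S v ltSk vS.
apply: valid_colorings_step => // u uS; apply: IH => //.
by move: ltSk; rewrite (cardsD1 v) vS.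
Qed.

Lemma exp_le_valid_colorings : beta ^+ #|V| <= #|valid_colorings [set: V]|%:R.
Proof.
suff gen S : beta ^+ #|S| <= #|valid_colorings S|%:R by rewrite -cardsT gen.
have [k] := ubnP #|S|; elim: k S => // k IH S ltSk.
have [->|[v vS]] := finset.set_0Vmem S; first by rewrite cards0 valid_colorings0.
apply: le_trans (valid_colorings_growth vS).
move: ltSk; rewrite (cardsD1 v S) vS exprS => ltSk.
by rewrite ler_pM2l // IH.
Qed.

End PartialColorings.

Lemma card_dependent_pairs (I U : finType) (A : {set I}) (B : I -> {set U}) (m n : nat) :
    (#|A| <= m)%N -> (forall i, i \in A -> (#|B i| <= n)%N) ->
  (#|[set p : I * U | (p.1 \in A) && (p.2 \in B p.1)]| <= m * n)%N.
Proof.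
move=> Am Bn; rewrite -sum1_card (eq_bigl (fun p => (p.1 \in A) && (p.2 \in B p.1))).
  rewrite -(pair_big_dep _ (fun i j => j \in B i) (fun _ _ => 1%N)) /=.
  apply: leq_trans (_ : \sum_(i in A) n <= _)%N; last by rewrite sum_nat_const leq_mul2r Am orbT.
  by apply: leq_sum => i /Bn; rewrite sum1_card.
by move=> p; rewrite inE.
Qed.

(** * Obstructions of a graph *)

Section Obstructions.
Variables (V : finType) (e : rel V).
Hypothesis e_sym : symmetric e.
Local Notation Delta := (max_degree e).

(** The three clauses are: [v] is an end of a path, [v] is an inner vertex of a
    path, and [v], [u], [x] have a common neighbor. The reversal of a path
    reduces its four positions to the first two. In each case the offending
    colorings are those with equal colors on [v] and [x], and on [u] and [y]. *)
Definition obstructions (v : V) : {set V * V * V} :=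
  [set t | let: (u, x, y) := t in
     [|| is_path4 e [:: v; u; x; y], is_path4 e [:: u; v; y; x]
       | [&& x == y, uniq [:: v; u; x]
           & [exists w, [&& e w v, e w u & e w x]]]]].

Lemma is_path4_rev a b c d : is_path4 e [:: a; b; c; d] = is_path4 e [:: d; c; b; a].
Proof.
rewrite /is_path4 -(rev_uniq [:: a; b; c; d]); congr andb; congr andb.
rewrite /= (e_sym d c) (e_sym c b) (e_sym b a) !andbT.
by case: (e a b); case: (e b c); case: (e c d).
Qed.

Lemma obstructions_neq v u x y : (u, x, y) \in obstructions v ->
  [/\ u != v, x != v, y != v, x != u & y != u].
Proof.
rewrite inE => /or3P[/and3P[_ + _]|/and3P[_ + _]|/and3P[/eqP <- + _]] => uq.
all: by split; apply: contraTneq uq => ->; rewrite /= !inE eqxx ?orbT ?andbF.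
Qed.

Lemma obstructions_move (C : Type) v u x y w :
    (u, x, y) \in obstructions v -> w \in [:: v; u; x; y] ->
  exists u' x' y', [/\ (u', x', y') \in obstructions w,
    {subset [:: u'; x'; y'] <= [:: v; u; x; y]}
  & forall f : {ffun V -> C}, f v = f x -> f u = f y -> f w = f x' /\ f u' = f y'].
Proof.
rewrite inE orbA => ob; rewrite !inE.
have sub3 a b c : a \in [:: v; u; x; y] -> b \in [:: v; u; x; y] ->
    c \in [:: v; u; x; y] -> {subset [:: a; b; c] <= [:: v; u; x; y]}.
  by move=> ha hb hc z; rewrite 3!in_cons in_nil orbF => /or3P[] /eqP->.
have in4 : [/\ v \in [:: v; u; x; y], u \in [:: v; u; x; y],
    x \in [:: v; u; x; y] & y \in [:: v; u; x; y]].
  by rewrite !inE !eqxx !orbT.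
case: in4 => iv iu ix iy; case/orP: ob => [path|/and3P[/eqP xy]].
  have ob a b c d : is_path4 e [:: a; b; c; d] || is_path4 e [:: b; a; d; c] ->
      (b, c, d) \in obstructions a by rewrite inE orbA => ->.
  have path' : is_path4 e [:: y; x; u; v] || is_path4 e [:: x; y; v; u].
    by rewrite is_path4_rev [X in _ || X]is_path4_rev.
  case/or4P=> /eqP->.
  - by exists u, x, y; split; [exact: ob | exact: sub3 |].
  - by exists v, y, x; split; [apply: ob; rewrite orbC | exact: sub3 |].
  - by exists y, v, u; split; [apply: ob; rewrite orbC | exact: sub3 |].
  - by exists x, u, v; split; [exact: ob | exact: sub3 |].
subst y; rewrite /= !inE negb_or !andbT => /andP[/andP[vu vx] ux].
case/existsP=> w' /and3P[wv wu wx].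
have tr a b : a != b -> b != x -> a != x -> e w' a -> e w' b ->  (b, x, x) \in obstructions a.
  move=> ab bx ax wa wb; rewrite inE eqxx /= !inE !negb_or ab bx ax /=.
  by rewrite !(introT existsP) ?orbT //; exists w'; rewrite wa wb.
rewrite orbb => /or3P[] /eqP->.
- by exists u, x, x; split; [apply: tr | exact: sub3 | ].
- exists v, x, x; split; [by apply: tr; rewrite // eq_sym | exact: sub3|].
  by move=> f fv fu; rewrite fu fv.
- exists u, v, v; split; [|exact: sub3|by move=> f -> ->].
  rewrite inE eqxx /= !inE !negb_or /= ![x == _]eq_sym ux vx [u == v]eq_sym vu /=.
  by rewrite !(introT existsP) ?orbT //; exists w'; rewrite wx wu.
Qed.

Lemma degree_le v : (#|neighbors e v| <= Delta)%N.
Proof. exact: (@leq_bigmax _ (degree e)). Qed.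

(** Each of the three kinds of obstruction at [v] is found by three successive
    choices, each of them of a neighbor of a vertex already known; [p] and [q]
    say of which one. *)
Lemma card_branching_triples v (p : V -> V) (q : V * V -> V) :
  (#|[set t : V * V * V | (t.1 \in [set s : V * V | (s.1 \in neighbors e v)
        && (s.2 \in neighbors e (p s.1))]) && (t.2 \in neighbors e (q t.1))]|
     <= Delta ^ 3)%N.
Proof.
rewrite !expnSr expn0 mul1n.
apply: (card_dependent_pairs (B := fun s => neighbors e (q s))) => [|s _]; last exact: degree_le.
by apply: (card_dependent_pairs (B := fun s => neighbors e (p s))) => [|s _]; exact: degree_le.
Qed.

Lemma card_obstructions v : (#|obstructions v| <= 3 * Delta ^ 3)%N.
Proof.
pose br p q := [set t : V * V * V | (t.1 \in [set s : V * V | (s.1 \in neighbors e v)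
        && (s.2 \in neighbors e (p s.1))]) && (t.2 \in neighbors e (q t.1))].
pose A1 := br id snd.
pose A2 := [set (t.1.1, t.2, t.1.2) | t in br (fun=> v) snd].
pose A3 := [set (t.1.2, t.2, t.2) | t in br id fst].
have sub : obstructions v \subset A1 :|: (A2 :|: A3).
  apply/fintype.subsetP => -[[u x] y]; rewrite !finset.in_setU inE => /or3P[ob|ob|ob].
  - apply/orP; left; rewrite !inE /=; move: ob; rewrite /is_path4 /=.
    by case/andP => _ /and4P[-> -> -> _].
  - apply/orP; right; apply/orP; left; apply/imsetP; exists ((u, y), x) => //.
    move: ob; rewrite /is_path4 /= => /andP[_ /and4P[uv vy yx _]].
    by rewrite !inE /= e_sym uv vy yx.
  - apply/orP; right; apply/orP; right.
    case/and3P: ob => /eqP-> _ /existsP[w /and3P[wv wu wy]].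
    by apply/imsetP; exists ((w, u), y) => //; rewrite !inE /= e_sym wv wu wy.
apply: leq_trans (subset_leq_card sub) _.
rewrite mulSn mulSn mul1n.
apply: leq_trans (leq_card_setU _ _) (leq_add (card_branching_triples _ _ _) _).
apply: leq_trans (leq_card_setU _ _) _.
by apply: leq_add; apply: leq_trans (leq_imset_card _ _) (card_branching_triples _ _ _).
Qed.

End Obstructions.

(** * From finite palettes to lists of natural numbers *)

(** The lists may be infinite; a finite part of the required size is enough for
    the lower bound. *)
Lemma counting_ge_seq (R : realType) (U : choiceType) (A : set U) (n : nat) :
    (n%:R%:E <= counting A :> \bar R)%E ->
  exists s : seq U, [/\ uniq s, forall c, c \in s -> A c & (n <= size s)%N].
Proof.
rewrite /counting; case: ifPn => /asboolP finA le.
  exists (finmap.enum_fset (fset_set A)); split; first exact: finmap.fset_uniq.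
    by move=> c; rewrite in_fset_set // inE.
  by move: le; rewrite lee_fin ler_nat.
have [B BA Bn] := infinite_set_fset n finA.
by exists (finmap.enum_fset B); split => //; exact: finmap.fset_uniq.
Qed.

Lemma uniq_le_counting (R : realType) (U : choiceType) (A : set U) (s : seq U) :
  uniq s -> (forall x, x \in s -> A x) -> ((size s)%:R%:E <= counting A :> \bar R)%E.
Proof.
move=> s_uniq sA; rewrite /counting; case: ifPn => [/asboolP finA|_]; last exact: leey.
rewrite lee_fin ler_nat; apply: uniq_leq_size => // x /sA Ax.
by rewrite in_fset_set // inE.
Qed.

Section GoodColorings.
Variables (V : finType) (e : rel V).
Implicit Types (phi : {ffun V -> nat}) (A : {set V}).

Lemma has_color_used_onceP phi A :
  has_color_used_once phi A <->
  exists2 x, x \in A & forall y, y \in A -> phi y = phi x -> y = x.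
Proof.
split=> [[c /eqP/cards1P[x Ex]]|[x xA x_uniq]].
  have /setIP[xA] : x \in A :&: color_class phi c by rewrite Ex set11.
  rewrite inE => /eqP xc; exists x => // y yA yx.
  by apply/finset.set1P; rewrite -Ex !inE yA yx xc eqxx.
exists (phi x); apply/eqP/cards1P; exists x; apply/finset.setP => y.
rewrite !inE; apply/andP/eqP => [[yA /eqP]|->]; [exact: x_uniq | by rewrite eqxx].
Qed.

Lemma used_once_path4 phi a b c d : phi a != phi b -> phi b != phi c -> phi c != phi d ->
  (phi a = phi c -> phi b = phi d -> False) ->
  has_color_used_once phi [set x in [:: a; b; c; d]].
Proof.
move=> ab bc cd nac; apply/has_color_used_onceP.
case: (eqVneq (phi a) (phi c)) => [ac|ac].
  exists b; first by rewrite !inE eqxx orbT.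
  have bd : phi b <> phi d := nac ac.
  move=> z; rewrite !inE => /or4P[] /eqP-> // E; exfalso;
    [move/eqP: ab | move/eqP: bc | ]; congruence.
case: (eqVneq (phi a) (phi d)) => [ad|ad].
  exists b; first by rewrite !inE eqxx orbT.
  move=> z; rewrite !inE => /or4P[] /eqP-> // E; exfalso; move/eqP: ab; move/eqP: bc; congruence.
exists a; first by rewrite !inE eqxx.
move=> z; rewrite !inE => /or4P[] /eqP-> // E; exfalso.
all: move/eqP: ab; move/eqP: ac; move/eqP: ad; congruence.
Qed.

Lemma used_once_triple phi a b c : (phi b = phi a -> phi c = phi a -> False) ->
  has_color_used_once phi [set x in [:: a; b; c]].
Proof.
move=> nabc; apply/has_color_used_onceP.
case: (eqVneq (phi b) (phi a)) => [ab|ab].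
  exists c; first by rewrite !inE eqxx !orbT.
  by move=> z; rewrite !inE => /or3P[] /eqP-> // E; exfalso; apply: nabc; congruence.
case: (eqVneq (phi c) (phi a)) => [ac|ac].
  exists b; first by rewrite !inE eqxx !orbT.
  move=> z; rewrite !inE => /or3P[] /eqP-> // E; exfalso; move/eqP: ab; congruence.
exists a; first by rewrite !inE eqxx.
by move=> z; rewrite !inE => /or3P[] /eqP-> // E; exfalso; move/eqP: ab; move/eqP: ac; congruence.
Qed.

Lemma set_of_card3 A : #|A| = 3%N -> exists a b c, uniq [:: a; b; c] /\ A = [set x in [:: a; b; c]].
Proof.
move=> A3; have := enum_uniq A; have := A3; rewrite cardE.
have := mem_enum A; case: (enum A) => [|a [|b [|c [|]]]] // EA _ u.
by exists a, b, c; split => //; apply/finset.setP => x; rewrite -EA inE.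
Qed.

Lemma good_of_valid (M : nat) (Lf : V -> {set 'I_M.+1}) (L : V -> set nat)
    (f : {ffun V -> 'I_M.+1}) :
    (forall v k, k \in Lf v -> L v (val k)) ->
    valid_on e ord0 Lf (obstructions e) [set: V] f ->
  good_coloring e L [ffun x => val (f x)].
Proof.
move=> LfL [fL _ fe fT]; have inT x : x \in [set: V] by rewrite inE.
have f_inj x y : val (f x) = val (f y) -> f x = f y by move/val_inj.
split.
- by move=> x y exy; rewrite !ffunE (inj_eq val_inj) fe.
- by move=> v; rewrite ffunE; apply/LfL/fL.
- move=> p pp; have := pp => /and3P[].
  case: p pp => [|a [|b [|c [|d [|]]]]] //= pp _ _ /and4P[ab bc cd _].
  apply: used_once_path4; rewrite !ffunE ?(inj_eq val_inj) ?fe //.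
  by move=> /f_inj ac /f_inj bd; apply: (fT a b c d) => //; rewrite inE pp.
- move=> v _ A /fintype.subsetP AN /set_of_card3[a [b [c [u EA]]]].
  have nb z : z \in [:: a; b; c] -> e v z.
    by move=> zA; have := AN z; rewrite EA !inE in zA *; apply.
  rewrite EA; apply: used_once_triple; rewrite !ffunE => /f_inj ba /f_inj ca.
  apply: (fT a b c c) => //; last by rewrite ba ca.
  rewrite inE; apply/orP; right; apply/orP; right; rewrite eqxx u /=.
  by apply/existsP; exists v; rewrite !nb // !inE eqxx ?orbT.
Qed.

End GoodColorings.

Lemma many_good_colorings (R : realType) (V : finType) (e : rel V) (L : V -> set nat) (beta : R) :
    simple_graph e -> 0 < beta ->
    (forall v, exists2 n : nat,
       beta + (max_degree e)%:R + (3 * max_degree e ^ 3)%:R / beta <= n%:R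
     & (n%:R%:E <= counting (L v) :> \bar R)%E) ->
  ((beta ^+ #|V|)%:E
     <= counting [set phi : {ffun V -> nat} | good_coloring e L phi]%classic)%E.
Proof.
move=> [e_sym e_irr] b0 Lbig.
have Bex v : exists s : seq nat, [/\ uniq s, forall c, c \in s -> L v c &
    beta + (max_degree e)%:R + (3 * max_degree e ^ 3)%:R / beta <= (size s)%:R].
  have [n bn /counting_ge_seq[s [s_uniq sL ns]]] := Lbig v.
  by exists s; split => //; apply: le_trans bn _; rewrite ler_nat.
have [B HB] := choice Bex.
pose M := \max_(v : V) \max_(c <- B v) c.
pose Lf v : {set 'I_M.+1} := [set k | val k \in B v].
have Lf_ge v : beta + (max_degree e)%:R + (3 * max_degree e ^ 3)%:R / beta <= #|Lf v|%:R.
  have [B_uniq _ Bv] := HB v; apply: le_trans Bv _; rewrite ler_nat cardE -(size_map val).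
  apply: uniq_leq_size => //.
  move=> c cB; have cM : (c < M.+1)%N.
    rewrite ltnS; apply: leq_trans (@leq_bigmax _ _ v).
    exact: (@leq_bigmax_seq _ _ xpredT id).
  by apply/mapP; exists (Ordinal cM) => //; rewrite mem_enum inE.
pose F := valid_colorings e ord0 Lf (obstructions e) [set: V].
have F_ge : beta ^+ #|V| <= #|F|%:R.
  apply: (exp_le_valid_colorings _ e_sym e_irr _ _ b0 (degree_le e)
    (card_obstructions e_sym) Lf_ge).
    by move=> v u x y; exact: obstructions_neq.
  by move=> v u x y w; exact: obstructions_move.
pose toN (f : {ffun V -> 'I_M.+1}) : {ffun V -> nat} := [ffun x => val (f x)].
have toN_inj : injective toN.
  by move=> f g /ffunP E; apply/ffunP => x; apply: val_inj; have := E x; rewrite !ffunE.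
apply: le_trans (_ : (size (map toN (enum F)))%:R%:E <= _)%E.
  by rewrite lee_fin size_map -cardE.
apply: uniq_le_counting; first by rewrite map_inj_uniq // enum_uniq.
move=> _ /mapP[f + ->]; rewrite mem_enum => /valid_coloringsP; apply: good_of_valid.
by move=> v k; rewrite inE; have [_ BL _] := HB v; exact: BL.
Qed.

(** * Subgraphs induced by two color classes *)

Section TwoColorClasses.
Variables (V : finType) (e : rel V) (L : V -> set nat) (phi : {ffun V -> nat}).
Hypotheses (e_sym : symmetric e) (e_irr : irreflexive e).
Hypothesis phi_good : good_coloring e L phi.
Variables (a b : nat).
Local Notation S := (color_class phi a :|: color_class phi b).

Lemma bicolored_path2 x y z : x \in S -> y \in S -> z \in S -> e x y -> e y z -> phi x = phi z.
Proof.
case: phi_good => ph _ _ _; rewrite !inE => /orP xS /orP yS /orP zS /ph xy /ph yz.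
by case: xS yS zS => /eqP Ex [] /eqP Ey [] /eqP Ez; move: xy yz; rewrite Ex Ey Ez ?eqxx.
Qed.

Lemma no_bicolored_path4 w x y z : w \in S -> x \in S -> y \in S -> z \in S ->
  uniq [:: w; x; y; z] -> e w x -> e x y -> e y z -> False.
Proof.
move=> wS xS yS zS u wx xy yz.
have wy := bicolored_path2 wS xS yS wx xy; have xz := bicolored_path2 xS yS zS xy yz.
case: phi_good => _ _ /(_ [:: w; x; y; z]) + _.
rewrite /is_path4 u /= wx xy yz => /(_ isT)/has_color_used_onceP[t].
rewrite !inE => tp t1; move: u; rewrite /= !inE !negb_or.
case/and4P=> /and3P[_ nwy _] /andP[_ nxz] _ _.
have in4 s : s \in [:: w; x; y; z] -> s \in [set s in [:: w; x; y; z]].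
  by move=> ?; rewrite inE.
case/or4P: tp => /eqP E; rewrite {}E in t1.
- by case/eqP: nwy; apply/esym/t1; rewrite ?in4 // !inE eqxx ?orbT.
- by case/eqP: nxz; apply/esym/t1; rewrite ?in4 // !inE eqxx ?orbT.
- by case/eqP: nwy; apply/t1; rewrite ?in4 // !inE eqxx ?orbT.
- by case/eqP: nxz; apply/t1; rewrite ?in4 // !inE eqxx ?orbT.
Qed.

Lemma no_bicolored_claw x y z t : x \in S -> y \in S -> z \in S -> t \in S ->
  uniq [:: y; z; t] -> e x y -> e x z -> e x t -> False.
Proof.
move=> xS yS zS tS u xy xz xt.
have yz : phi y = phi z by apply: (bicolored_path2 yS xS zS); rewrite // e_sym.
have yt : phi y = phi t by apply: (bicolored_path2 yS xS tS); rewrite // e_sym.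
have sub : [set s in [:: y; z; t]] \subset neighbors e x.
  by apply/fintype.subsetP => s; rewrite !inE => /or3P[] /eqP->.
have card3 : #|[set s in [:: y; z; t]]| = 3%N.
  by rewrite cardsE (card_uniqP u).
case: phi_good => _ _ _ /(_ x); rewrite /degree -{1}card3 subset_leq_card //.
case/(_ isT _ sub card3)/has_color_used_onceP => s; rewrite inE => sA s1.
have col r : r \in [:: y; z; t] -> phi r = phi y.
  by rewrite !inE => /or3P[] /eqP->.
have all_s r : r \in [:: y; z; t] -> r = s.
  by move=> rA; apply: s1; [rewrite inE | rewrite !col].
have ys : y = s by apply: all_s; rewrite mem_head.
have zs : z = s by apply: all_s; rewrite in_cons mem_head orbT.
by move: u; rewrite cons_uniq ys zs mem_head.
Qed.

Lemma induced_connect_sym : connect_sym (induced_rel e S).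
Proof. by apply: sym_connect_sym => r s; rewrite /induced_rel /= andbCA e_sym. Qed.

Lemma component_eq x (C : {set V}) : x \in C ->
    (forall y z, y \in C -> z \in S -> e y z -> z \in C) ->
    (forall y, y \in C -> connect (induced_rel e S) x y) ->
  [set y | connect (induced_rel e S) x y] = C.
Proof.
move=> xC clC conC; apply/finset.setP => y; rewrite inE.
apply/idP/idP => [xy|]; last exact: conC.
have sym := induced_connect_sym.
have cl : fingraph.closed (induced_rel e S) C.
  apply: (intro_closed sym) => r s /and3P[_ sS rs] rC.
  exact: clC rC sS rs.
by rewrite -(closed_connect cl xy).
Qed.

(** A vertex with two neighbors in two color classes spans with them a whole
    component: the two neighbors share a color and so are not adjacent, a third
    neighbor of the center would give a claw, and a further neighbor of a leaf
    would prolong the path to four vertices. *)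
Lemma cherry_closed x y z : x \in S -> y \in S -> z \in S -> y != z -> e x y -> e x z ->
  forall r s, r \in [:: y; x; z] -> s \in S -> e r s -> s \in [:: y; x; z].
Proof.
move=> xS yS zS nyz xy xz.
have neq r s : e r s -> r != s by apply: contraTneq => ->; rewrite e_irr.
have leaf y' z' s : y' \in S -> z' \in S -> y' != z' -> e x y' -> e x z' ->
    s \in S -> e y' s -> s = x.
  move=> yS' zS' nyz' xy' xz' sS ys; apply/eqP; apply: contraT => sx; exfalso.
  have yx' : e y' x by rewrite e_sym.
  have sy : e s y' by rewrite e_sym.
  have sz : s != z'.
    case: phi_good => ph _ _ _; apply: contraTneq ys => ->; apply/negP => /ph.
    by rewrite (bicolored_path2 yS' xS zS' yx' xz') eqxx.
  apply: (@no_bicolored_path4 s y' x z') => //.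
  by rewrite /= !inE !negb_or sx sz nyz' !neq.
move=> r s + sS; rewrite !in_cons !in_nil !orbF => /or3P[] /eqP-> rs.
- by rewrite (leaf y z s yS zS nyz xy xz sS rs) eqxx orbT.
- apply: contraT; rewrite !negb_or => /and3P[sy _ sz]; exfalso.
  apply: (no_bicolored_claw xS yS zS sS _ xy xz rs).
  by rewrite /= !inE negb_or nyz ![_ == s]eq_sym sy sz.
- by rewrite eq_sym in nyz; rewrite (leaf z y s zS yS nyz xz xy sS rs) eqxx orbT.
Qed.

Lemma induces_path3 x y z : uniq [:: y; x; z] -> e y x -> e x z -> ~~ e y z ->
  induces_path e [set t in [:: y; x; z]].
Proof.
move=> u yx xz /negPf yz; exists [:: y; x; z]; split=> // r s.
move: u; rewrite /= !inE negb_or andbT => /andP[/andP[/negPf nyx /negPf nyz] /negPf nxz].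
by case/or3P=> /eqP-> /or3P[] /eqP->;
  rewrite ?eqxx ?nyx ?nyz ?nxz ?[x == y]eq_sym ?[z == y]eq_sym ?[z == x]eq_sym
    ?nyx ?nyz ?nxz ?eqxx ?[e x y]e_sym ?[e z x]e_sym ?[e z y]e_sym ?yx ?xz ?yz ?e_irr.
Qed.

Lemma cherry_component x y z r : x \in S -> y \in S -> z \in S -> y != z -> e x y -> e x z ->
    r \in [:: y; x; z] ->
  induces_path e [set t | connect (induced_rel e S) r t] /\
  (#|[set t | connect (induced_rel e S) r t]| <= 3)%N.
Proof.
move=> xS yS zS nyz xy xz rA.
have ph := let: And4 h _ _ _ := phi_good in h.
have neq s t : e s t -> s != t by apply: contraTneq => ->; rewrite e_irr.
have yx : e y x by rewrite e_sym.
have star s : s \in [:: y; x; z] -> connect (induced_rel e S) x s.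
  rewrite !inE => /or3P[] /eqP-> //; apply: connect1.
    by rewrite /induced_rel /= xS yS.
  by rewrite /induced_rel /= xS zS.
have sym := induced_connect_sym.
rewrite (@component_eq r [set t in [:: y; x; z]]).
- split; last by rewrite cardsE; exact: card_size.
  apply: induces_path3 => //.
    by rewrite /= !inE negb_or nyz !neq.
  apply/negP => /ph; rewrite (bicolored_path2 yS xS zS) //.
  by rewrite eqxx.
- by rewrite inE.
- move=> s t; rewrite [s \in _]inE [t \in [set _ in _]]inE.
  exact: cherry_closed.
- move=> s; rewrite inE => sA; apply: connect_trans (star s sA).
  by rewrite sym star.
Qed.

(** Take a vertex [x] of the component and a neighbor [y] of [x], if there is one.
    If [x] or [y] has a second neighbor, then it is the center of the component;
    otherwise the component is the edge [x y]. *)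
Lemma bicolored_component C : is_component e S C -> induces_path e C /\ (#|C| <= 3)%N.
Proof.
case=> x xS ->.
have [y /andP[yS xy]|no_y] := pickP [pred y | (y \in S) && e x y]; last first.
  rewrite (@component_eq x [set t in [:: x]]).
  - split; last by rewrite cardsE (leq_trans (card_size _)).
    exists [:: x]; split=> // r s; rewrite !inE => /eqP-> /eqP->.
    by rewrite e_irr /= eqxx.
  - by rewrite !inE.
  - move=> r s; rewrite inE mem_seq1 => /eqP-> sS xs.
    by have := no_y s; rewrite /= sS xs.
  - by move=> r; rewrite inE mem_seq1 => /eqP->.
have yx : e y x by rewrite e_sym.
have [z /and3P[zS nzy xz]|no_z] := pickP [pred z | [&& z \in S, z != y & e x z]].
  by apply: (@cherry_component x y z) => //; rewrite ?inE ?eqxx ?orbT // eq_sym.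
have [z /and3P[zS nzx yz]|no_z'] := pickP [pred z | [&& z \in S, z != x & e y z]].
  by apply: (@cherry_component y x z) => //; rewrite ?inE ?eqxx ?orbT // eq_sym.
have nxy : x == y = false by apply: contraTF xy => /eqP->; rewrite e_irr.
rewrite (@component_eq x [set t in [:: x; y]]).
- split; last by rewrite cardsE (leq_trans (card_size _)).
  exists [:: x; y]; split=> //; first by rewrite /= inE nxy.
  move=> r s; rewrite !inE.
  by case/orP=> /eqP-> /orP[] /eqP->; rewrite /= ?eqxx ?[y == x]eq_sym ?nxy ?e_irr ?xy ?yx.
- by rewrite !inE eqxx.
- move=> r s; rewrite inE !in_cons in_nil orbF => /orP[] /eqP-> sS es; rewrite !inE.
    by have := no_z s; rewrite /= sS es andbT => /negbFE ->; rewrite orbT.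
  by have := no_z' s; rewrite /= sS es andbT => /negbFE ->.
- move=> r; rewrite !inE => /orP[] /eqP-> //; apply: connect1.
  by rewrite /induced_rel /= xS yS.
Qed.

End TwoColorClasses.

(** * The number of good colorings *)

(** [beta + 15/2 Delta^3 / beta] would already be [2 beta]; the coefficient 3
    leaves room, which is why crude counts of obstructions suffice. *)
Lemma list_size_bound (R : realType) (D : nat) (beta : R) : (0 < D)%N ->
    beta = Num.sqrt (15 / 2 * D%:R ^+ 3) ->
  beta + D%:R + (3 * D ^ 3)%:R / beta <= Num.sqrt 30 * (D%:R `^ (3 / 2)) + D%:R + 1 / 3.
Proof.
move=> D0 betaE; have d0 : 0 < D%:R :> R by rewrite ltr0n.
have x0 : 0 < 15 / 2 * D%:R ^+ 3 :> R by rewrite mulr_gt0 ?exprn_gt0 // divr_gt0.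
have b0 : 0 < beta by rewrite betaE sqrtr_gt0.
have bb : beta ^+ 2 = 15 / 2 * D%:R ^+ 3 by rewrite betaE sqr_sqrtr // ltW.
have -> : Num.sqrt 30 * (D%:R `^ (3 / 2)) = 2 * beta.
  rewrite powRrM powR_mulrn ?ltW // powR12_sqrt ?exprn_ge0 ?ltW //.
  rewrite betaE -sqrtrM //.
  have -> : 30 * D%:R ^+ 3 = 2 ^+ 2 * (15 / 2 * D%:R ^+ 3) :> R by field.
  by rewrite sqrtrM ?sqr_ge0 // sqrtr_sqr ger0_norm.
have : (3 * D ^ 3)%:R / beta <= beta.
  rewrite ler_pdivrMr // -expr2 bb natrM natrX ler_pM2r ?exprn_gt0 //.
  by rewrite ler_pdivlMr // -natrM ler_nat.
lra.
Qed.

Theorem corollary6 (R : realType) (V : finType) (e : rel V)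
  (he : simple_graph e) (L : V -> set nat)
  (hL : list_assignment
          ((Num.ceil (Num.sqrt 30 * ((max_degree e)%:R `^ (3 / 2))
                      + (max_degree e)%:R + 1 / 3 : R))%:~R : R) L) :
  (((15 / 2 * (max_degree e)%:R ^+ 3 : R) `^ (#|V|%:R / 2))%:E
     <= counting [set phi : {ffun V -> nat} | good_coloring e L phi]%classic)%E
  /\
  (forall phi : {ffun V -> nat}, good_coloring e L phi ->
     forall a b : nat, a <> b ->
     forall C : {set V},
       is_component e (color_class phi a :|: color_class phi b) C ->
       induces_path e C /\ (#|C| <= 3)%N).
Proof.
split; last first.
  have [e_sym e_irr] := he; move=> phi phi_good a b _ C.
  exact: (bicolored_component e_sym e_irr phi_good).
set D := max_degree e in hL *; set x : R := 15 / 2 * D%:R ^+ 3.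
have x0 : 0 <= x by rewrite mulr_ge0 ?exprn_ge0 // divr_ge0.
rewrite mulrC powRrM powR12_sqrt // powR_mulrn ?sqrtr_ge0 //.
(* Without vertices [beta = 1] does: the condition on the lists is void. *)
have [V0|Vpos] := posnP #|V|.
  rewrite V0 expr0 -(expr1n R #|V|); apply: many_good_colorings => // v.
  by have := fintype0 v V0.
(* Without edges the claimed bound is [0]. *)
have [D0|Dpos] := posnP D.
  rewrite /x D0 expr0n mulr0 sqrtr0 expr0n -[(_ == _)%N]negbK -lt0n Vpos.
  exact: (@uniq_le_counting _ _ _ [::]).
apply: many_good_colorings => //.
  by rewrite sqrtr_gt0 mulr_gt0 ?exprn_gt0 ?ltr0n // divr_gt0.
move=> v; have [_] := hL v; set c := Num.ceil _ => Lc.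
have c0 : 0 <= c.
  rewrite ceil_ge0; apply: lt_le_trans (ltrN10 R) _.
  by rewrite !addr_ge0 ?mulr_ge0 ?powR_ge0.
exists `|c|%N; last by rewrite natr_absz ger0_norm.
apply: le_trans (list_size_bound Dpos erefl) _.
by rewrite natr_absz ger0_norm // ceil_ge.
Qed.
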